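(* Let $p\in(0,1)$, let $\mathbb{X}_0$ be the two-sided discrete stochastic hull of the random period doubling substitution, and let $\nu$ be the patch frequency measure on it. The topological point spectrum of $(\mathbb{X}_0,\mathbb{Z},\nu)$ is trivial: the only continuous eigenfunction (up to a multiplicative constant) is the constant one, with $k=0$.
   Context: Random period doubling substitution: on the alphabet $\{a,b\}$, with $q=1-p$, $\rho$ maps $a\mapsto ab$ with probability $p$ and $a\mapsto ba$ with probability $q$, and $b\mapsto aa$; it is applied independently to every letter of a word and independently in each iteration step. A finite word is legal if it is a subword of some realisation of $\rho^k(a)$ for some $k\in\mathbb{N}$. $\mathbb{X}_0\subset\{a,b\}^{\mathbb{Z}}$ is the set of bi-infinite sequences all of whose finite subwords are legal, with the product topology and the $\mathbb{Z}$-action of the shift, written as $x\mapsto n+x$. The patch frequency measure $\nu$ is the shift-invariant, ergodic probability measure on $\mathbb{X}_0$ giving the cylinder set of each legal word $w$ the mass $\lim_{n\to\infty}2^{-n}\,\mathbb{E}(\text{number of occurrences of }w\text{ in }\rho^n(a))$. An eigenfunction is a nonzero $f\in L^2(\mathbb{X}_0,\nu)$ with $f(n+x)=e^{2\pi i kn}f(x)$ for some $k\in\mathbb{T}=[0,1)$ (addition modulo $1$), all $n\in\mathbb{Z}$ and $\nu$-a.e. $x$; it is continuous if it is represented by a continuous function on $\mathbb{X}_0$ for which the relation holds for all $x\in\mathbb{X}_0$. *)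

(* Defs.v *)
From HB Require Import structures.
From mathcomp Require Import all_boot all_order all_algebra.
From mathcomp Require Import complex.
From mathcomp Require Import all_classical all_reals all_analysis.

Set Implicit Arguments.
Unset Strict Implicit.
Unset Printing Implicit Defensive.

Import Order.TTheory GRing.Theory Num.Theory.
Import numFieldNormedType.Exports.

Local Open Scope classical_set_scope.
Local Open Scope ring_scope.

(* The alphabet {a, b} is [bool], whose library topology is the discrete one. *)
Notation letter := bool (only parsing).
Notation letter_a := false (only parsing).
Notation letter_b := true (only parsing).
Notation word := (seq bool) (only parsing).

(* A finitely supported random word is the list of its outcomes with their
   weights; the same word may be listed several times, its probability is then
   the sum of the weights. *)
Definition rword (R : realType) : Type := seq (R * word).

Definition expectation {R : realType} (D : rword R) (X : word -> R) : R :=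
  \sum_(o <- D) o.1 * X o.2.

Definition rpd_letter {R : realType} (p : R) (l : letter) : rword R :=
  if l == letter_a
  then [:: (p, [:: letter_a; letter_b]); (1 - p, [:: letter_b; letter_a])]
  else [:: (1, [:: letter_a; letter_a])].

(* Weights are multiplied: the letters are substituted independently. *)
Fixpoint rpd_word {R : realType} (p : R) (u : word) : rword R :=
  if u is l :: u' then
    [seq (o1.1 * o2.1, o1.2 ++ o2.2) | o1 <- rpd_letter p l, o2 <- rpd_word p u']
  else [:: (1, [::])].

Definition rpd_step {R : realType} (p : R) (D : rword R) : rword R :=
  [seq (o1.1 * o2.1, o2.2) | o1 <- D, o2 <- rpd_word p o1.2].

Definition rpd_iter {R : realType} (p : R) (n : nat) (u : word) : rword R :=
  iter n (rpd_step p) [:: (1, u)].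

Definition realisation {R : realType} (p : R) (k : nat) (u v : word) : Prop :=
  exists2 c : R, 0 < c & (c, v) \in rpd_iter p k u.

Definition legal {R : realType} (p : R) (w : word) : Prop :=
  exists k v, realisation p k [:: letter_a] v /\ infix w v.

Definition occurrences (w u : word) : nat :=
  count (fun i => prefix w (drop i u)) (iota 0 (size u)).

(* {a, b}^Z with the product topology and its Borel sigma-algebra. *)
Definition fullshift : Type := prod_topology (fun _ : int => bool).

HB.instance Definition _ := Pointed.on fullshift.
HB.instance Definition _ := Nbhs.on fullshift.
HB.instance Definition _ := Topological.on fullshift.
HB.instance Definition _ := Uniform.on fullshift.
HB.instance Definition _ :=
  Measurable.copy fullshift (g_sigma_algebraType (@open fullshift)).

(* The Z-action x |-> n + x, moving the origin n places to the right. *)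
Definition translate (n : int) (x : fullshift) : fullshift := fun m => x (m + n).

(* The subword of x of length l starting at position m. *)
Definition subword (x : fullshift) (m : int) (l : nat) : word :=
  [seq x (m + i%:Z) | i <- iota 0 l].

Definition hull {R : realType} (p : R) : set fullshift :=
  [set x | forall m l, legal p (subword x m l)].

Definition cylinder {R : realType} (p : R) (w : word) : set fullshift :=
  [set x | hull p x /\ subword x 0 (size w) = w].

Definition shift_invariant {R : realType} (nu : probability fullshift R) : Prop :=
  forall n (A : set fullshift), measurable A -> nu (translate n @^-1` A) = nu A.

Definition ergodic {R : realType} (nu : probability fullshift R) : Prop :=
  forall A : set fullshift, measurable A ->
    (forall n, translate n @^-1` A = A) -> nu A = 0%E \/ nu A = 1%E.

(* Measures on the hull are measures on the full shift giving it mass 1. *)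
Definition patch_frequency_measure {R : realType} (p : R)
    (nu : probability fullshift R) : Prop :=
  [/\ nu (hull p) = 1%E,
      shift_invariant nu,
      ergodic nu &
      forall w, legal p w ->
        (fun n => (expectation (rpd_iter p n [:: letter_a])
                     (fun u => (occurrences w u)%:R) / 2 ^+ n)%:E)
          @ \oo --> nu (cylinder p w)].

Definition expi2pi {R : realType} (t : R) : R[i] :=
  (cos (2 * pi * t) +i* sin (2 * pi * t))%C.

(* L^2 of the hull; elements are represented by functions on the full shift
   whose values off the hull are irrelevant. *)
Definition square_integrable {R : realType} (p : R)
    (nu : probability fullshift R) (f : fullshift -> R[i]) : Prop :=
  [/\ measurable_fun (hull p) (fun x => complex.Re (f x)),
      measurable_fun (hull p) (fun x => complex.Im (f x)) &
      (\int[nu]_(x in hull p) ((Normc.normc (f x)) ^+ 2)%:E < +oo)%E].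

Definition eigenfunction {R : realType} (p : R)
    (nu : probability fullshift R) (k : R) (f : fullshift -> R[i]) : Prop :=
  [/\ 0 <= k < 1,
      square_integrable p nu f,
      ~ {ae nu, forall x, hull p x -> f x = 0} &
      forall n : int, {ae nu, forall x, hull p x ->
        f (translate n x) = expi2pi (k * n%:~R) * f x}].

Definition continuous_eigenfunction {R : realType} (p : R)
    (nu : probability fullshift R) (k : R) (f : fullshift -> R[i]) : Prop :=
  eigenfunction p nu k f /\
  exists g : fullshift -> (R[i])^o,
    [/\ {within hull p, continuous g},
        {ae nu, forall x, hull p x -> f x = g x} &
        forall (n : int) x, hull p x ->
          g (translate n x) = expi2pi (k * n%:~R) * g x].

Definition topological_point_spectrum {R : realType} (p : R)
    (nu : probability fullshift R) : set R :=
  [set k | exists f, continuous_eigenfunction p nu k f].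

(* Main.v *)
Require Import Defs.
From HB Require Import structures.
From mathcomp Require Import all_boot all_order all_algebra.
From mathcomp Require Import complex.
From mathcomp Require Import all_classical all_reals all_analysis.
From mathcomp Require Import zify lra.

Set Implicit Arguments.
Unset Strict Implicit.
Unset Printing Implicit Defensive.

Import Order.TTheory GRing.Theory Num.Theory.
Import numFieldNormedType.Exports.

Local Open Scope classical_set_scope.
Local Open Scope ring_scope.

(** The hull contains many periodic points.  Since aab has baabaa as an image,
    which is baa twice, and baa has aabaab as an image, all powers of aab are
    legal; so are then all powers of u1 u2 v, for any images u1, u2 of a and v
    of b under the [k]-th iterate, and the periodic sequence of period
    u1 u2 v lies in the hull.  Every legal word occurs in an image of a of any
    large level, so two prescribed legal words can be made to occur in u1 and
    in u2: any two points of the hull are limits of points on common orbits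
    ([hull_transitive]).  Taking u1 = u2, of length [2 ^ k], makes a single
    prescribed word occur twice at distance [2 ^ k] ([hull_recurrent]).

    Let g be a continuous eigenfunction and [zeta] the number of modulus one by
    which a translation by 1 multiplies it.
    Its modulus is constant on orbits, hence on the hull, and it is not zero.
    The point of period aab then gives [zeta ^+ 3 = 1].  Along the
    approximations with a repeated window, the distance from
    [zeta ^+ (2 ^ k)] to 1 tends to 0; but for a cube root of unity this
    distance is the distance from [zeta] to 1, as squaring exchanges
    the two nontrivial cube roots.  Hence [zeta = 1].  Now g itself is constant
    on orbits, hence on the hull ([eigenvector_invariant]).

    The constant function 1 is square integrable and not almost everywhere zero
    because the hull, which is closed and therefore measurable, has mass 1. *)

(** * Composition and concatenation of realisations *)

Lemma rpd_letter_gt0 (R : realType) (p : R) (l : letter) (o : R * word) :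
  0 < p < 1 -> o \in rpd_letter p l -> 0 < o.1.
Proof.
case/andP=> p0 p1; case: l; rewrite /rpd_letter /= !inE.
  by move=> /eqP->.
by case/orP=> /eqP-> //=; rewrite subr_gt0.
Qed.

Lemma rpd_word_gt0 (R : realType) (p : R) (u : word) (o : R * word) :
  0 < p < 1 -> o \in rpd_word p u -> 0 < o.1.
Proof.
move=> p01; elim: u o => [|l u IHu] o /=; first by rewrite inE => /eqP->.
case/allpairsPdep=> e1 [e2] [e1l /IHu e20 ->] /=.
by rewrite mulr_gt0 // (rpd_letter_gt0 p01 e1l).
Qed.

Lemma size_rpd_word (R : realType) (p : R) (u : word) (o : R * word) :
  o \in rpd_word p u -> size o.2 = (2 * size u)%N.
Proof.
elim: u o => [|l u IHu] o /=; first by rewrite inE => /eqP->.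
case/allpairsPdep=> e1 [e2] [e1l /IHu e2u ->] /=.
rewrite size_cat e2u mulnS; congr addn; move: e1l.
by case: l; rewrite /rpd_letter /= !inE; [|case/orP] => /eqP->.
Qed.

Lemma rpd_word_cat (R : realType) (p : R) (u u' : word) (o o' : R * word) :
  o \in rpd_word p u -> o' \in rpd_word p u' ->
  (o.1 * o'.1, o.2 ++ o'.2) \in rpd_word p (u ++ u').
Proof.
move=> + o'u'; elim: u o => [|l u IHu] o /=.
  by rewrite inE => /eqP-> /=; rewrite mul1r; case: o' o'u'.
case/allpairsPdep=> e1 [e2] [e1l /IHu e2u ->] /=.
apply/allpairsPdep; exists e1, (e2.1 * o'.1, e2.2 ++ o'.2); split=> //=.
by rewrite mulrA catA.
Qed.

Lemma realisation0 (R : realType) (p : R) (u : word) : realisation p 0 u u.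
Proof. by exists 1; rewrite ?ltr01 // /rpd_iter /= inE. Qed.

Lemma realisation1P (R : realType) (p : R) (u v : word) :
  realisation p 1 u v <-> exists2 c : R, 0 < c & (c, v) \in rpd_word p u.
Proof.
split=> -[c c0 cv]; exists c => //.
  move: cv; rewrite /rpd_iter /= /rpd_step => /allpairsPdep[e1 [e2]] [].
  by rewrite inE => /eqP-> + [-> ->]; rewrite mul1r; case: e2.
rewrite /rpd_iter /= /rpd_step; apply/allpairsPdep.
by exists (1, u), (c, v); split; rewrite ?inE //= mul1r.
Qed.

(** The weight of a two-step outcome is a product; positivity of all the weights
    of [rpd_word] is what makes its first factor positive too. *)
Lemma realisationSP (R : realType) (p : R) (k : nat) (u w : word) :
  0 < p < 1 ->
  realisation p k.+1 u w <->
  exists2 v, realisation p k u v & realisation p 1 v w.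
Proof.
move=> p01; split.
  case=> c c0; rewrite /rpd_iter iterS => /allpairsPdep[[c1 v] [[c2 w']]] [].
  move=> /= c1v c2w' [cE wE]; subst w'; have c20 := rpd_word_gt0 p01 c2w'.
  exists v; last by apply/realisation1P; exists c2.
  by exists c1 => //; move: c0; rewrite cE pmulr_lgt0.
case=> v [c1 c10 c1v] /realisation1P[c2 c20 c2w].
exists (c1 * c2); first exact: mulr_gt0.
by rewrite /rpd_iter iterS; apply/allpairsPdep; exists (c1, v), (c2, w).
Qed.

Lemma realisation_trans (R : realType) (p : R) (m n : nat) (u v w : word) :
  0 < p < 1 -> realisation p m u v -> realisation p n v w ->
  realisation p (m + n) u w.
Proof.
move=> p01 uv; elim: n w => [|n IHn] w.
  by case=> c _; rewrite /rpd_iter /= inE => /eqP[_ ->]; rewrite addn0.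
move/(realisationSP _ _ _ p01) => [x vx xw]; rewrite addnS.
by apply/realisationSP => //; exists x => //; exact: IHn.
Qed.

Lemma realisation_cat (R : realType) (p : R) (k : nat) (u u' v v' : word) :
  0 < p < 1 -> realisation p k u v -> realisation p k u' v' ->
  realisation p k (u ++ u') (v ++ v').
Proof.
move=> p01; elim: k v v' => [|k IHk] v v'.
  case=> c _; rewrite /rpd_iter /= inE => /eqP[_ ->].
  case=> c' _; rewrite /rpd_iter /= inE => /eqP[_ ->].
  exact: realisation0.
move=> /(realisationSP _ _ _ p01)[x ux /realisation1P[c c0 xv]].
move=> /(realisationSP _ _ _ p01)[x' ux' /realisation1P[c' c0' xv']].
apply/realisationSP => //; exists (x ++ x'); first exact: IHk.
apply/realisation1P; exists (c * c'); first exact: mulr_gt0.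
exact: rpd_word_cat xv xv'.
Qed.

Lemma size_realisation (R : realType) (p : R) (k : nat) (u v : word) :
  0 < p < 1 -> realisation p k u v -> size v = (2 ^ k * size u)%N.
Proof.
move=> p01; elim: k v => [|k IHk] v.
  by case=> c _; rewrite /rpd_iter /= inE mul1n => /eqP[_ ->].
move=> /(realisationSP _ _ _ p01)[x /IHk ux /realisation1P[c _ xv]].
by rewrite (size_rpd_word xv) ux expnS mulnA.
Qed.

Lemma realisation_ab (R : realType) (p : R) :
  0 < p < 1 -> realisation p 1 [:: letter_a] [:: letter_a; letter_b].
Proof.
case/andP=> p0 _; apply/realisation1P; exists p => //.
by rewrite /rpd_letter /= !mulr1 !inE eqxx.
Qed.

Lemma realisation_ba (R : realType) (p : R) :
  0 < p < 1 -> realisation p 1 [:: letter_a] [:: letter_b; letter_a].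
Proof.
case/andP=> _ p1; apply/realisation1P; exists (1 - p); rewrite ?subr_gt0 //.
by rewrite /rpd_letter /= !mulr1 !inE eqxx orbT.
Qed.

Lemma realisation_aa (R : realType) (p : R) :
  realisation p 1 [:: letter_b] [:: letter_a; letter_a].
Proof.
by apply/realisation1P; exists 1 => //; rewrite /= mulr1 inE.
Qed.

Lemma realisation_ex (R : realType) (p : R) (k : nat) (u : word) :
  0 < p < 1 -> exists v, realisation p k u v.
Proof.
move=> p01; have ex1 x : exists y, realisation p 1 x y.
  elim: x => [|l x [y xy]].
    by exists [::]; apply/realisation1P; exists 1; rewrite /= ?inE ?ltr01.
  rewrite -cat1s; case: l.
    exists ([:: letter_a; letter_a] ++ y).
    exact: realisation_cat (realisation_aa _) _.
  exists ([:: letter_a; letter_b] ++ y).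
  exact: realisation_cat (realisation_ab _) _.
elim: k => [|k [v uv]]; first by exists u; exact: realisation0.
by have [w vw] := ex1 v; exists w; apply/realisationSP => //; exists v.
Qed.

(** * Legal words and the powers of aab *)

Lemma legal_infix (R : realType) (p : R) (u v : word) :
  infix u v -> legal p v -> legal p u.
Proof.
by move=> uv [k [w [aw vw]]]; exists k, w; split=> //; exact: infix_trans uv vw.
Qed.

(** An occurrence of [u] inside a realisation [s ++ u ++ t] of a is carried
    along by substituting [s] and [t] arbitrarily. *)
Lemma legal_realisation (R : realType) (p : R) (k : nat) (u v : word) :
  0 < p < 1 -> legal p u -> realisation p k u v -> legal p v.
Proof.
move=> p01 [m [w [aw /infixP[s [t wE]]]]] uv.
have [s' ss'] := realisation_ex k s p01.
have [t' tt'] := realisation_ex k t p01.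
exists (m + k)%N, (s' ++ v ++ t'); split; last by apply/infixP; exists s', t'.
apply: realisation_trans aw _ => //; rewrite wE.
by do 2?apply: realisation_cat.
Qed.

(** An image of level [k] of the letter a is a prefix of one of level [k.+1],
    because a itself begins its image ab. *)
Lemma legal_level (R : realType) (p : R) (u : word) : 0 < p < 1 ->
  legal p u -> exists k0, forall k, (k0 <= k)%N ->
    exists2 v, realisation p k [:: letter_a] v & infix u v.
Proof.
move=> p01 [k0 [v0 [av0 uv0]]]; exists k0 => k.
elim: k => [|k IHk]; first by rewrite leqn0 => /eqP <-; exists v0.
rewrite leq_eqVlt => /orP[/eqP <-|/IHk[v av uv]]; first by exists v0.
have [w bw] := realisation_ex k [:: letter_b] p01.
exists (v ++ w); last exact: infix_catr.
have := realisation_cat p01 av bw.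
exact: (realisation_trans p01 (realisation_ab p01)).
Qed.

Definition repeat_word (n : nat) (w : word) : word := flatten (nseq n w).

Lemma repeat_word_cat (m n : nat) (w : word) :
  repeat_word (m + n) w = repeat_word m w ++ repeat_word n w.
Proof. by rewrite /repeat_word nseqD flatten_cat. Qed.

Lemma repeat_wordM (m n : nat) (w : word) :
  repeat_word m (repeat_word n w) = repeat_word (m * n) w.
Proof.
by elim: m => [//|m IHm]; rewrite mulSn repeat_word_cat -IHm.
Qed.

Lemma realisation_repeat (R : realType) (p : R) (k n : nat) (u v : word) :
  0 < p < 1 -> realisation p k u v ->
  realisation p k (repeat_word n u) (repeat_word n v).
Proof.
move=> p01 uv; elim: n => [|n IHn]; last exact: realisation_cat.
have [w w0] := realisation_ex k [::] p01.
have /eqP := size_realisation p01 w0.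
by rewrite muln0 size_eq0 => /eqP wE; rewrite wE in w0.
Qed.

Definition aab : word := [:: letter_a; letter_a; letter_b].

(** The images ba, ab, aa of the letters of aab form baa twice, and the images
    aa, ba, ab of the letters of baa form aab twice. *)
Lemma realisation_aab (R : realType) (p : R) : 0 < p < 1 ->
  realisation p 2 aab (repeat_word 4 aab).
Proof.
move=> p01; pose baa := [:: letter_b; letter_a; letter_a].
have ba := realisation_ba p01; have ab := realisation_ab p01.
have aa := realisation_aa p.
apply: (@realisation_trans _ _ 1 1 _ (repeat_word 2 baa)) => //.
  exact: (realisation_cat p01 ba (realisation_cat p01 ab aa)).
apply: (realisation_repeat 2 p01 (u := baa) (v := repeat_word 2 aab)).
exact: (realisation_cat p01 aa (realisation_cat p01 ba ab)).
Qed.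

(** Two steps multiply the exponent by four, so one power already yields the
    next. *)
Lemma legal_repeat_aab (R : realType) (p : R) (n : nat) :
  0 < p < 1 -> legal p (repeat_word n aab).
Proof.
move=> p01; elim: n => [|n IHn].
  by exists 0, [:: letter_a]; split; [exact: realisation0|].
case: n IHn => [_|n IHn].
  (* a is sent to ba, then to aa|ab *)
  exists 2, [:: letter_a; letter_a; letter_a; letter_b]; split=> //.
  apply: (@realisation_trans _ _ 1 1) (realisation_ba p01) _ => //.
  by have := realisation_cat p01 (realisation_aa p) (realisation_ab p01).
have aab4 := realisation_repeat n.+1 p01 (realisation_aab p01).
have := legal_realisation p01 IHn aab4.
apply: legal_infix; apply/infixP; exists [::], (repeat_word (3 * n + 2) aab).
by rewrite cat0s -repeat_word_cat repeat_wordM; congr repeat_word; lia.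
Qed.

(** * Periodic points and the dynamics of the hull *)

Definition periodic_point (w : word) : fullshift :=
  fun m => nth letter_a w `|(m %% (size w)%:Z)%Z|%N.

Lemma nth_repeat_word (n i : nat) (w : word) : (i < n * size w)%N ->
  nth letter_a (repeat_word n w) i = nth letter_a w (i %% size w).
Proof.
elim: n i => [//|n IHn] i lti; rewrite /repeat_word /= nth_cat.
case: ltnP => [ltiw|leiw]; first by rewrite modn_small.
by rewrite IHn; [rewrite -{2}(subnK leiw) modnDr|lia].
Qed.

Lemma size_repeat_word (n : nat) (w : word) :
  size (repeat_word n w) = (n * size w)%N.
Proof. by rewrite size_flatten /shape map_nseq sumn_nseq mulnC. Qed.

Lemma subword_periodic_point (w : word) (m : int) (l : nat) : (0 < size w)%N ->
  exists n, infix (subword (periodic_point w) m l) (repeat_word n w).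
Proof.
move=> w0; pose r := `|(m %% (size w)%:Z)%Z|%N.
(* The subword starts at phase [r], so [r + l] letters are enough. *)
exists (r + l)%N.
have -> : subword (periodic_point w) m l =
          take l (drop r (repeat_word (r + l) w)).
  have rl : (r + l <= size (repeat_word (r + l) w))%N.
    by rewrite size_repeat_word leq_pmulr.
  apply: (@eq_from_nth _ letter_a).
    by rewrite size_map size_iota size_takel // size_drop; lia.
  move=> i; rewrite size_map size_iota => il.
  rewrite (nth_map 0%N) ?size_iota // nth_iota // add0n nth_take // nth_drop.
  rewrite nth_repeat_word; last first.
    by rewrite -size_repeat_word; apply: leq_trans rl; rewrite ltn_add2l.
  rewrite /periodic_point; congr nth.
  have rE : (r : int) = (m %% (size w)%:Z)%Z.
    by rewrite /r gez0_abs // modz_ge0 // eqz_nat -lt0n.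
  by rewrite -modzDml -rE -PoszD modz_nat.
apply: infix_trans (infix_take _ _) _; apply/infixP.
by exists (take r (repeat_word (r + l) w)), [::]; rewrite cats0 cat_take_drop.
Qed.

Lemma periodic_point_nat (w : word) (i : nat) : (i < size w)%N ->
  periodic_point w i%:Z = nth letter_a w i.
Proof. by move=> iw; rewrite /periodic_point modz_nat modn_small. Qed.

Lemma translate_periodic_point (w : word) :
  translate (size w) (periodic_point w) = periodic_point w.
Proof. by apply/funext => m; rewrite /translate /periodic_point modzDr. Qed.

(** The three letters of aab are substituted independently, and repeating the
    same choice over a legal power of aab gives a power of [u1 ++ u2 ++ v]. *)
Lemma hull_periodic_point (R : realType) (p : R) (k : nat) (u1 u2 v : word) :
  0 < p < 1 -> realisation p k [:: letter_a] u1 ->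
  realisation p k [:: letter_a] u2 -> realisation p k [:: letter_b] v ->
  hull p (periodic_point (u1 ++ u2 ++ v)).
Proof.
move=> p01 au1 au2 bv m l.
have aabw : realisation p k aab (u1 ++ u2 ++ v).
  exact: (realisation_cat p01 au1 (realisation_cat p01 au2 bv)).
have [|n] := @subword_periodic_point (u1 ++ u2 ++ v) m l.
  by rewrite (size_realisation p01 aabw) muln_gt0 expn_gt0.
move/legal_infix; apply.
apply: legal_realisation (legal_repeat_aab n p01) _ => //.
exact: realisation_repeat aabw.
Qed.

Lemma subword_translate (n m : int) (l : nat) (x : fullshift) :
  subword (translate n x) m l = subword x (m + n) l.
Proof. by apply/eq_map => i; rewrite /translate addrAC. Qed.

Lemma hull_translate (R : realType) (p : R) (n : int) (x : fullshift) :
  hull p x -> hull p (translate n x).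
Proof. by move=> px m l; rewrite subword_translate. Qed.

Definition agree (L : nat) (x y : fullshift) : Prop :=
  forall m : int, (`|m| <= L)%N -> x m = y m.

Definition window (L : nat) (x : fullshift) : word :=
  subword x (- L%:Z) (2 * L).+1.

Lemma agree_periodic_point (L : nat) (s t : word) (x : fullshift) :
  agree L (translate (size s + L)%N (periodic_point (s ++ window L x ++ t))) x.
Proof.
move=> m mL; rewrite /translate.
have szW : size (window L x) = (2 * L).+1 by rewrite size_map size_iota.
have -> : m + (size s + L)%N%:Z = (size s + `|(m + L%:Z)%R|)%N%:Z by lia.
rewrite periodic_point_nat; last by rewrite !size_cat szW; lia.
rewrite nth_cat ifN; last by lia.
rewrite addKn nth_cat ifT; last by rewrite szW; lia.
rewrite (nth_map 0%N) ?size_iota ?nth_iota; try lia.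
by congr (x _); lia.
Qed.

Lemma translateD (m n : int) (x : fullshift) :
  translate n (translate m x) = translate (m + n) x.
Proof. by apply/funext => i; rewrite /translate addrAC addrA. Qed.

(** The windows of [x] and [y] are placed in the images of the first and of the
    second letter of aab, at a level high enough for both. *)
Lemma hull_transitive (R : realType) (p : R) (L : nat) (x y : fullshift) :
  0 < p < 1 -> hull p x -> hull p y ->
  exists (z : fullshift) (n : int),
    [/\ hull p z, agree L z x & agree L (translate n z) y].
Proof.
move=> p01 px py.
have [k1 lev1] := legal_level p01 (px (- L%:Z) (2 * L).+1).
have [k2 lev2] := legal_level p01 (py (- L%:Z) (2 * L).+1).
have [u1 au1 /infixP[s1 [t1 u1E]]] := lev1 _ (leq_maxl k1 k2).
have [u2 au2 /infixP[s2 [t2 u2E]]] := lev2 _ (leq_maxr k1 k2).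
have [v bv] := realisation_ex (maxn k1 k2) [:: letter_b] p01.
pose z := periodic_point (u1 ++ u2 ++ v).
exists (translate (size s1 + L)%N z).
exists (- (size s1 + L)%N%:Z + (size (u1 ++ s2) + L)%N%:Z).
split; first exact/hull_translate/(hull_periodic_point p01 au1 au2 bv).
  rewrite /z u1E -!catA; exact: agree_periodic_point.
rewrite translateD addrA subrr add0r /z u2E -!catA catA.
exact: agree_periodic_point.
Qed.

(** Both letters a of aab receive the same image, of length [2 ^ k], so that the
    window comes back after [2 ^ k] steps.  The exponent depends on the window;
    all that matters is that [2 ^ k] is prime to 3. *)
Lemma hull_recurrent (R : realType) (p : R) (L : nat) (x : fullshift) :
  0 < p < 1 -> hull p x ->
  exists (z : fullshift) (k : nat),
    [/\ hull p z, agree L z x & agree L (translate (2 ^ k)%N z) x].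
Proof.
move=> p01 px.
have [k lev] := legal_level p01 (px (- L%:Z) (2 * L).+1).
have [u au /infixP[s [t uE]]] := lev _ (leqnn k).
have [v bv] := realisation_ex k [:: letter_b] p01.
pose z := periodic_point (u ++ u ++ v).
exists (translate (size s + L)%N z), k.
split; first exact/hull_translate/(hull_periodic_point p01 au au bv).
  rewrite /z {1}uE -!catA; exact: agree_periodic_point.
rewrite translateD.
have -> : (size s + L)%N%:Z + (2 ^ k)%N%:Z = (size (u ++ s) + L)%N%:Z.
  by rewrite size_cat (size_realisation p01 au) muln1 -PoszD addnC addnA.
rewrite /z {3}uE -!catA catA; exact: agree_periodic_point.
Qed.

(** * Topology of the hull *)

Lemma agree_cvg (z : nat -> fullshift) (x : fullshift) :
  (forall L, agree L (z L) x) -> z @ \oo --> x.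
Proof.
move=> zx; apply/cvg_sup => m A /=.
case=> B [[C oC <-] /= Cx] BA.
exists `|m|%N => // L /= mL; apply: BA; rewrite /= zx //.
Qed.

(** Legality of the subword at a given place depends on finitely many
    coordinates only. *)
Lemma closed_hull (R : realType) (p : R) : closed (hull p).
Proof.
have -> : hull p = \bigcap_m \bigcap_l [set x | legal p (subword x m l)].
  by apply/seteqP; split=> [x px m _ l _|x px m l]; exact: px.
apply: closed_bigI => m _; apply: closed_bigI => l _.
rewrite -openC openE => x /= nx.
have : \forall y \near x, subword y m l = subword x m l.
  rewrite /subword; elim: (iota 0 l) => [|i s IHs]; first by near=> y.
  have ex : \forall y \near x, (y : fullshift) (m + i%:Z) = x (m + i%:Z).
    have := @proj_continuous int (fun=> bool) (m + i%:Z) x [set x (m + i%:Z)].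
    by apply; exact: discrete_set1.
  by near=> y => /=; congr cons; near: y.
by apply: filterS => y /= ->.
Unshelve. all: by end_near. Qed.

Lemma measurable_hull (R : realType) (p : R) : measurable (hull p).
Proof.
rewrite -[hull p]setCK; apply: measurableC; apply: sub_sigma_algebra.
by rewrite openC; exact: closed_hull.
Qed.

(** * Continuous eigenfunctions *)

Lemma expi2piD (R : realType) (s t : R) :
  expi2pi (s + t) = expi2pi s * expi2pi t.
Proof.
rewrite /expi2pi mulrDr cosD sinD; apply/eqP; rewrite eq_complex /=.
by rewrite [X in _ && (X == _)]addrC [sin _ * cos _]mulrC !eqxx.
Qed.

Lemma expi2pi0 (R : realType) : expi2pi (0 : R) = 1.
Proof. by rewrite /expi2pi mulr0 cos0 sin0. Qed.

Lemma expi2pi_nat (R : realType) (t : R) (n : nat) :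
  expi2pi (t * n%:~R) = expi2pi t ^+ n.
Proof.
rewrite -pmulrn mulr_natr; elim: n => [|n IHn]; first by rewrite expi2pi0.
by rewrite mulrS exprS expi2piD IHn.
Qed.

Lemma norm_expi2pi (R : realType) (t : R) : `|expi2pi t| = 1.
Proof. by rewrite normc_def /= cos2Dsin2 sqrtr1. Qed.

(** As [cos (2 * pi * t) = 1 - 2 * sin (pi * t) ^+ 2], and the sine is positive
    inside a half period, only [t = 0] is possible. *)
Lemma expi2pi_eq1 (R : realType) (t : R) :
  0 <= t < 1 -> expi2pi t = 1 -> t = 0.
Proof.
case/andP=> t0 t1 [+ _].
have -> : 2 * pi * t = (pi * t) *+ 2 by rewrite -[RHS]mulr_natl mulrA.
rewrite cos_mulr2n cos2sin2 => cos1.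
have [t_gt0|t_le0] := ltP 0 t; last by apply/eqP; rewrite eq_le t_le0.
have : 0 < sin (pi * t) ^+ 2.
  rewrite exprn_gt0 // sin_gt0_pi // mulr_gt0 ?pi_gt0 //=.
  by rewrite gtr_pMr ?pi_gt0.
lra.
Qed.

Lemma eigenfunction_cvg (R : realType) (p : R) (g : fullshift -> (R[i])^o)
    (z : nat -> fullshift) (x : fullshift) :
  {within hull p, continuous g} -> hull p x -> (forall L, hull p (z L)) ->
  (forall L, agree L (z L) x) -> g (z L) @[L --> \oo] --> g x.
Proof.
move=> /subspace_continuousP gc px pz zx.
apply: cvg_comp (gc x px) => A Ax.
have [N _ NA] := agree_cvg zx Ax; exists N => // L NL.
exact: NA (pz L).
Qed.

Lemma eigenvector_common_orbit (R : realType) (p : R)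
    (g : fullshift -> (R[i])^o) (x y : fullshift) :
  0 < p < 1 -> {within hull p, continuous g} -> hull p x -> hull p y ->
  exists (z : nat -> fullshift) (n : nat -> int),
    [/\ forall L, hull p (z L), g (z L) @[L --> \oo] --> g x &
        g (translate (n L) (z L)) @[L --> \oo] --> g y].
Proof.
move=> p01 gc px py.
have /choice[zn znP] : forall L, exists zn : fullshift * int, [/\ hull p zn.1,
    agree L zn.1 x & agree L (translate zn.2 zn.1) y].
  by move=> L; have [z [n zP]] := hull_transitive L p01 px py; exists (z, n).
have pz L : hull p (zn L).1 by case: (znP L).
exists (fun L => (zn L).1), (fun L => (zn L).2); split=> //.
  by apply: eigenfunction_cvg gc px pz _ => L; case: (znP L).
apply: eigenfunction_cvg gc py _ _ => L; last by case: (znP L).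
exact/hull_translate/pz.
Qed.

Definition continuous_eigenvector (R : realType) (p k : R)
    (g : fullshift -> (R[i])^o) : Prop :=
  {within hull p, continuous g} /\
  forall (n : int) x, hull p x ->
    g (translate n x) = expi2pi (k * n%:~R) * g x.

(** The modulus of an eigenfunction is constant along orbits, so
    [hull_transitive] and continuity make it constant on the hull. *)
Lemma eigenvector_norm (R : realType) (p k : R) (g : fullshift -> (R[i])^o)
    (x y : fullshift) :
  0 < p < 1 -> continuous_eigenvector p k g -> hull p x -> hull p y ->
  `|g x| = `|g y|.
Proof.
move=> p01 [gc ge] px py.
have [z [n [pz cx cy]]] := eigenvector_common_orbit p01 gc px py.
have zE : (fun L => `|g (translate (n L) (z L))|) = (fun L => `|g (z L)|).
  by apply/funext => L; rewrite ge ?pz // normrM norm_expi2pi mul1r.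
have cNy : `|g (z L)| @[L --> \oo] --> `|g y|.
  by rewrite -zE; exact: cvg_norm cy.
exact: norm_cvg_unique (cvg_norm cx) cNy.
Qed.

Lemma eigenvector_invariant (R : realType) (p : R) (g : fullshift -> (R[i])^o)
    (x y : fullshift) :
  0 < p < 1 -> continuous_eigenvector p 0 g -> hull p x -> hull p y ->
  g x = g y.
Proof.
move=> p01 [gc ge] px py.
have [z [n [pz cx cy]]] := eigenvector_common_orbit p01 gc px py.
have zE : (fun L => g (translate (n L) (z L))) = (fun L => g (z L)).
  by apply/funext => L; rewrite ge ?pz // mul0r expi2pi0 mul1r.
by rewrite zE in cy; exact: norm_cvg_unique cx cy.
Qed.

(** The eigenfunction does not vanish on the periodic point of period aab, its
    modulus there being the same as at [x]. *)
Lemma eigenvalue_cube (R : realType) (p k : R) (g : fullshift -> (R[i])^o)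
    (x : fullshift) :
  0 < p < 1 -> continuous_eigenvector p k g -> hull p x -> g x != 0 ->
  expi2pi k ^+ 3 = 1.
Proof.
move=> p01 gk px gx0.
have pz : hull p (periodic_point aab).
  have id0 l := realisation0 p [:: l].
  exact: hull_periodic_point p01 (id0 letter_a) (id0 letter_a) (id0 letter_b).
have gz0 : g (periodic_point aab) != 0.
  by rewrite -normr_eq0 -(eigenvector_norm p01 gk px pz) normr_eq0.
have [_ ge] := gk; have := ge (size aab) _ pz.
rewrite translate_periodic_point expi2pi_nat -{1}[g _]mul1r.
by move/(mulIf gz0).
Qed.

(** Squaring a cube root of unity [b] keeps its distance to 1, as
    [b ^+ 2 - 1 = b ^+ 2 * (1 - b)]. *)
Lemma norm_cube_root_pow2 (F : numDomainType) (a : F) (k : nat) :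
  a ^+ 3 = 1 -> `|a ^+ (2 ^ k) - 1| = `|a - 1|.
Proof.
move=> a3; elim: k => [//|k <-].
set b := a ^+ (2 ^ k).
have b3 : b ^+ 3 = 1 by rewrite -exprM mulnC exprM a3 expr1n.
have Nb : `|b ^+ 2| = 1.
  have /eqP : `|b| ^+ 3 = 1 by rewrite -normrX b3 normr1.
  by rewrite pexpr_eq1 // => /eqP Nb1; rewrite normrX Nb1 expr1n.
have -> : a ^+ (2 ^ k.+1) - 1 = b ^+ 2 * (1 - b).
  by rewrite expnSr exprM -/b mulrBr mulr1 -exprSr b3.
by rewrite normrM Nb mul1r distrC.
Qed.

(** Along points [z] of [hull_recurrent] tending to [x], the values of [g] at
    [z] and at its translate by a power of 2 have the same limit, while the norm
    of their difference is constantly [`|expi2pi k - 1| * `|g x|]. *)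
Lemma eigenvalue_trivial (R : realType) (p k : R) (g : fullshift -> (R[i])^o)
    (x : fullshift) :
  0 < p < 1 -> continuous_eigenvector p k g -> hull p x -> g x != 0 ->
  expi2pi k = 1.
Proof.
move=> p01 gk px gx0; have a3 := eigenvalue_cube p01 gk px gx0.
have [gc ge] := gk.
have /choice[zn znP] : forall L, exists zn : fullshift * nat, [/\ hull p zn.1,
    agree L zn.1 x & agree L (translate (2 ^ zn.2)%N zn.1) x].
  by move=> L; have [z [n zP]] := hull_recurrent L p01 px; exists (z, n).
pose z L := (zn L).1; pose z' L := translate (2 ^ (zn L).2)%N (z L).
have pz L : hull p (z L) by case: (znP L).
have cz : g (z L) @[L --> \oo] --> g x.
  by apply: eigenfunction_cvg gc px pz _ => L; case: (znP L).
have cz' : g (z' L) @[L --> \oo] --> g x.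
  apply: eigenfunction_cvg gc px _ _ => L; last by case: (znP L).
  exact/hull_translate/pz.
have zE : (fun L => `|g (z' L) - g (z L)|) = (fun=> `|expi2pi k - 1| * `|g x|).
  apply/funext => L; rewrite ge ?pz // expi2pi_nat -{2}[g (z L)]mul1r -mulrBl.
  by rewrite normrM norm_cube_root_pow2 // (eigenvector_norm p01 gk (pz L) px).
have c0 : `|g (z' L) - g (z L)| @[L --> \oo] --> `|g x - g x|.
  exact: cvg_norm (cvgB cz' cz).
rewrite zE subrr normr0 in c0.
have : `|expi2pi k - 1| * `|g x| = 0 by exact: norm_cvg_unique (cvg_cst _) c0.
by move/eqP; rewrite mulf_eq0 !normr_eq0 (negPf gx0) orbF subr_eq0 => /eqP.
Qed.

Lemma ae_hull_ex (R : realType) (p : R) (nu : probability fullshift R)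
    (P : fullshift -> Prop) :
  nu (hull p) = 1%E -> {ae nu, forall x, hull p x -> P x} ->
  exists2 x, hull p x & P x.
Proof.
move=> nu1 [N [mN N0 NP]]; apply: contrapT => noP.
have HN : hull p `<=` N.
  by move=> x px; apply: NP => /= /(_ px) Px; apply: noP; exists x.
have := le_measure nu; rewrite /= => /(_ (hull p) N).
rewrite !inE => /(_ (measurable_hull p) mN HN).
by rewrite [X in (X <= _)%E]nu1 N0 lee_fin ler10.
Qed.

Lemma continuous_eigenfunction_cst (R : realType) (p k : R)
    (nu : probability fullshift R) (f : fullshift -> R[i]) :
  0 < p < 1 -> continuous_eigenfunction p nu k f ->
  k = 0 /\
  exists2 c : R[i], c != 0 & {ae nu, forall x, hull p x -> f x = c}.
Proof.
move=> p01 [[k01 _ f0 _] [g [gc fg ge]]].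
have gk : continuous_eigenvector p k g by [].
have [x px gx0] : exists2 x, hull p x & g x != 0.
  apply: contrapT => g0; apply: f0; apply: filterS fg => x fgx px.
  by rewrite fgx //; apply/eqP/negPn/negP => gx0; apply: g0; exists x.
have k0 : k = 0 by exact: expi2pi_eq1 k01 (eigenvalue_trivial p01 gk px gx0).
split=> //; exists (g x) => //.
apply: filterS fg => y fgy py; rewrite fgy //.
by rewrite k0 in gk; exact: eigenvector_invariant gk py px.
Qed.

Lemma continuous_eigenfunction_one (R : realType) (p : R)
    (nu : probability fullshift R) :
  nu (hull p) = 1%E -> continuous_eigenfunction p nu 0 (fun=> 1).
Proof.
move=> nu1; split; last first.
  exists (fun=> 1); split.
  - by move=> x; exact: cvg_cst.
  - by apply: aeW => x _.
  - by move=> n x _; rewrite mul0r expi2pi0 mulr1.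
split.
- by rewrite lexx ltr01.
- split; try exact: measurable_cst.
  rewrite (eq_integral (cst 1%E)); last first.
    by move=> x _ /=; rewrite !expr1n expr0n addr0 sqrtr1 expr1n.
  rewrite integral_cst ?mul1e; last exact: measurable_hull.
  by rewrite [X in (X < _)%E]nu1 ltry.
- by move=> /(ae_hull_ex nu1)[x _ /eqP]; rewrite oner_eq0.
- by move=> n; apply: aeW => x _; rewrite mul0r expi2pi0 mulr1.
Qed.

Theorem proposition7p11 (R : realType) (p : R) (nu : probability fullshift R) :
  0 < p < 1 -> patch_frequency_measure p nu ->
  [/\ topological_point_spectrum p nu = [set 0],
      continuous_eigenfunction p nu 0 (fun _ => 1) &
      forall (k : R) (f : fullshift -> R[i]),
        continuous_eigenfunction p nu k f ->
        k = 0 /\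
        exists2 c : R[i], c != 0 & {ae nu, forall x, hull p x -> f x = c}].
Proof.
move=> p01 [nu1 _ _ _]; have one := continuous_eigenfunction_one nu1.
split=> //; last by move=> k f; exact: continuous_eigenfunction_cst.
apply/seteqP; split=> [k [f /(continuous_eigenfunction_cst p01)[]] //|k ->].
by exists (fun=> 1).
Qed.
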